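(* For $0<p<2$, $$\lim_{\eta\to0}\frac{\bar\rho_p(\eta)}{\eta^p\log^{2-p}\log\frac1\eta}=1.$$
   Context: $\mathcal F_p(\eta)$ denotes the set of probability distributions $F$ on $[1,\infty)$ with $\int\log^p(\mu)\,dF(\mu)\le\eta^p$. For a scalar random $\mu\sim F$ and $X\mid\mu\sim\mathrm{Exp}(\mu)$ (exponential with mean $\mu$), the univariate minimax-Bayes risk is $\bar\rho_p(\eta)=\inf_\delta\sup_{F\in\mathcal F_p(\eta)}\mathbb{E}_F\mathbb{E}_\mu(\log\delta(X)-\log\mu)^2$, the infimum over measurable $\delta:[0,\infty)\to(0,\infty)$. *)

(* Defs.v *)
From HB Require Import structures.
From mathcomp Require Import all_boot all_order all_algebra.
From mathcomp Require Import all_classical all_reals all_analysis.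
Set Implicit Arguments. Unset Strict Implicit. Unset Printing Implicit Defensive.
Import Order.TTheory GRing.Theory Num.Theory.
Import numFieldNormedType.Exports.
Local Open Scope classical_set_scope.
Local Open Scope ring_scope.

Definition supported_on_ge1 {R : realType} (F : probability R R) : Prop :=
  F (`[1%R, +oo[%classic : set R) = 1%E.

Definition in_Fp {R : realType} (p eta : R) (F : probability R R) : Prop :=
  supported_on_ge1 F /\
  (\int[F]_(mu in (`[1%R, +oo[%classic : set R)) ((ln mu) `^ p)%:E <= (eta `^ p)%:E)%E.

Definition admissible_estimator {R : realType} (delta : R -> R) : Prop :=
  measurable_fun (`[0%R, +oo[%classic : set R) delta /\ (forall x : R, 0 <= x -> 0 < delta x).

(* E_mu (log delta(X) - log mu)^2 for X | mu ~ Exp with mean mu (density e^{-x/mu}/mu on [0,oo)). *)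
Definition cond_risk {R : realType} (delta : R -> R) (mu : R) : \bar R :=
  (\int[lebesgue_measure]_(x in (`[0%R, +oo[%classic : set R))
     ((expR (- (x / mu)) / mu) * (ln (delta x) - ln mu) ^+ 2)%:E)%E.

Definition bayes_risk {R : realType} (F : probability R R) (delta : R -> R) : \bar R :=
  (\int[F]_(mu in (`[1%R, +oo[%classic : set R)) cond_risk delta mu)%E.

Definition minimax_bayes_risk {R : realType} (p eta : R) : \bar R :=
  ereal_inf [set s | exists delta : R -> R, admissible_estimator delta /\
     s = ereal_sup [set r | exists F : probability R R, in_Fp p eta F /\ r = bayes_risk F delta]].

(* Main.v *)
Require Import Defs.
From HB Require Import structures.
From mathcomp Require Import all_boot all_order all_algebra.
From mathcomp Require Import all_classical all_reals all_analysis.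
From mathcomp Require Import measurable_realfun ring lra.
Import Order.TTheory GRing.Theory Num.Theory.
Import numFieldNormedType.Exports.
Local Open Scope classical_set_scope.
Local Open Scope ring_scope.

(** With th = ln mu, N = ln (1/eta) and L = ln N, both bounds on the minimax risk
    are eta^p L^(2-p) times a function of L tending to 1.

    Upper bound: the hard threshold estimator, equal to 1 on [0, t] and to x
    beyond, with t = e^3 N. Below the threshold its bias contributes
    th^2 P(X <= t) <= (ln t)^(2-p) th^p. Above it, the squared noise
    ln^2 (X/mu) contributes at most K th^p when th >= 1 and at most
    K e^(-t/2e) <= K eta^p when th < 1. Integrating against F gives
    ((L + 3)^(2-p) + 2K) eta^p.

    Lower bound: the prior putting mass eta^p / th^p at mu = N / L and the rest
    at 1. Under mu = N / L, X lies in [0, p N / 2] with probability tending to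
    1, and there the posterior odds still overwhelmingly favour mu = 1, so nearly
    the full loss th^2 is paid; and th = L - ln L is asymptotic to L. *)

(** * Uniform bound on the integral of the squared log noise *)

(* 7680 = 2 * 2^5 * 5!, from [e^(y/2) >= (y/2)^5 / 5!] for [y >= 1]. *)
Lemma ln_sqr_expR_le (R : realType) (y : R) : 0 < y ->
  y * expR (- (y / 2)) * (ln y ^+ 2 * (1 + ln y ^+ 2)) <= 7680.
Proof.
move=> y0; set l := ln y.
have yE : y = expR l by rewrite /l lnK.
have key : y * (l ^+ 2 * (1 + l ^+ 2)) <= 7680 * expR (y / 2).
  have [l0|l0] := leP 0 l.
    have ly : l <= y by rewrite ltW// /l ln_sublinear.
    have y1 : 1 <= y by rewrite yE -expR0 ler_expR.
    have h2 : 0 <= y / 2 by lra.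
    have /= := expR_ge1Dxn 4 h2.
    rewrite (_ : 5`!%:R = 120 :> R)// => he.
    have l2 : l ^+ 2 <= y ^+ 2 by rewrite lerXn2r ?nnegrE//; lra.
    have : l ^+ 2 * (1 + l ^+ 2) <= y ^+ 2 * (1 + y ^+ 2).
      by apply: ler_pM => //; nra.
    move=> hl.
    have hy : y ^+ 2 * (1 + y ^+ 2) <= 2 * y ^+ 4.
      suff : y ^+ 2 <= y ^+ 4 by move=> ?; lra.
      by rewrite ler_weXn2l.
    have hm : y * (l ^+ 2 * (1 + l ^+ 2)) <= y * (2 * y ^+ 4).
      by rewrite ler_pM2l//; lra.
    apply: (le_trans hm).
    have -> : y * (2 * y ^+ 4) = 2 * y ^+ 5 by ring.
    have e5 : (y / 2) ^+ 5 = y ^+ 5 / 32 by field.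
    by rewrite e5 in he; lra.
  (* Here [y < 1]: [1/y = e^(-l)] dominates [1 + l^4 / 24], and [l^2 <= (1 + l^4) / 2], so the
     factor [y] absorbs the logarithms. *)
  have h2 : 0 <= - l by lra.
  have /= := expR_ge1Dxn 3 h2.
  rewrite (_ : 4`!%:R = 24 :> R)// expRN -yE => he.
  have e4 : (- l) ^+ 4 = l ^+ 4 by ring.
  rewrite e4 in he.
  have h3 : 1 <= expR (y / 2) by have := expR_ge1Dx (y / 2); lra.
  have h4 : l ^+ 2 * (1 + l ^+ 2) <= 48 * y^-1.
    have -> : l ^+ 2 * (1 + l ^+ 2) = l ^+ 2 + l ^+ 4 by ring.
    have := sqr_ge0 (l ^+ 2); rewrite -exprM.
    have := sqr_ge0 (l ^+ 2 - 1).
    rewrite (_ : (l ^+ 2 - 1) ^+ 2 = l ^+ 4 - 2 * l ^+ 2 + 1); last by ring.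
    lra.
  have := ler_wpM2l (ltW y0) h4.
  have -> : y * (48 * y^-1) = 48 by field; rewrite gt_eqF.
  lra.
rewrite mulrAC expRN ler_pdivrMr ?expR_gt0//.
Qed.

Lemma is_derive_atan_ln (R : realType) (c x : R) : 0 < x ->
  is_derive x 1 (fun x => atan (ln x - c)) (x^-1 / (1 + (ln x - c) ^+ 2)).
Proof.
move=> x0.
rewrite mulrC.
apply: (@is_derive1_comp _ atan (fun x => ln x - c)).
have -> : x^-1 = x^-1 - 0 by rewrite subr0.
apply: is_deriveB.
  exact: is_derive1_ln.
Qed.

Lemma integral_atan_ln_le (R : realType) (c a b : R) : 0 < a -> a < b ->
  (\int[lebesgue_measure]_(x in `[a, b]) (x^-1 / (1 + (ln x - c) ^+ 2))%:E <= pi%:E)%E.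
Proof.
move=> a0 ab.
have dF (x : R) : 0 < x -> derivable (fun x => atan (ln x - c)) x 1.
  by move=> /(is_derive_atan_ln _ c)[].
rewrite (continuous_FTC2 (F := fun x => atan (ln x - c))) //.
- rewrite -EFinD lee_fin.
  have := atan_ltpi2 (ln b - c); have := atan_gtNpi2 (ln a - c).
  lra.
- apply: continuous_in_subspaceT => x; rewrite inE/= in_itv/= => /andP[ax xb].
  have x0 : 0 < x by exact: lt_le_trans ax.
  have cl : {for x, continuous (fun x => ln x - c)}.
    apply: cvgB; [exact: continuous_ln|exact: cvg_cst].
  apply: cvgM; first by apply: cvgV => //; rewrite gt_eqF.
  apply: cvgV; first by rewrite gt_eqF// ltr_wpDr// sqr_ge0.
  apply: cvgD; first exact: cvg_cst.
  exact: cvgM.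
- have cF (x : R) : 0 < x -> {for x, continuous (fun x => atan (ln x - c))}.
    by move=> x0; apply/differentiable_continuous/derivable1_diffP/dF.
  split.
  + move=> x; rewrite in_itv/= => /andP[ax _]; exact: dF (lt_trans a0 ax).
  + exact/cvg_at_right_filter/cF.
  + exact/cvg_at_left_filter/cF/(lt_trans a0).
- move=> x; rewrite in_itv/= => /andP[ax xb].
  by rewrite derive1E; have [_ ->] := is_derive_atan_ln _ c x (lt_trans a0 ax).
Qed.

(** On nonnegative reals inversion is the power of exponent -1, including at 0 where both are 0;
    oddness covers the negative reals. *)
Lemma measurable_invr (R : realType) : measurable_fun setT (@GRing.inv R).
Proof.
have -> : @GRing.inv R = fun x => if 0 <= x then x `^ (- 1) else - (- x) `^ (- 1).
  apply/funext => x; have [x0|x0] := leP 0 x; first by rewrite powR_inv1.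
  by rewrite powR_inv1 ?oppr_ge0 1?ltW// invrN opprK.
apply: measurable_fun_ifT.
- exact: measurable_fun_ler.
- exact: measurable_powR.
- apply: measurable_funN; apply: (measurableT_comp (measurable_powR _)).
  exact: measurable_funN.
Qed.

Lemma measurable_exp_density (R : realType) (mu : R) :
  measurable_fun setT (fun x : R => expR (- (x / mu)) / mu).
Proof.
apply: measurable_funM => //; apply: (measurableT_comp (@measurable_expR R)).
by apply: measurable_funN; exact: measurable_funM.
Qed.

Lemma integral_oo_atan_ln_le (R : realType) (c : R) :
  (\int[lebesgue_measure]_(x in `]0%R, +oo[) (x^-1 / (1 + (ln x - c) ^+ 2))%:E <= pi%:E)%E.
Proof.
(* Compact intervals exhausting the open half-line, for monotone convergence. The right end [n.+2]
   keeps the first one nondegenerate. *)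
pose F (n : nat) : set R := `[n.+1%:R^-1, n.+2%:R]%classic.
have n1 (n : nat) : 1 <= n.+1%:R :> R by rewrite ler1n.
have FE : `]0%R, +oo[%classic = \bigcup_n F n.
  apply/seteqP; split => x /=; rewrite in_itv/= ?andbT => x0.
    have [m _ hm] : exists2 m : nat, True & x^-1 + x < m.+1%:R.
      exists (Num.truncn (x^-1 + x)) => //.
      exact: truncnS_gt.
    exists m => //; rewrite /F /= in_itv/=; apply/andP; split.
      rewrite invf_ple ?posrE//.
      by rewrite ltW// (le_lt_trans _ hm)// lerDl ltW.
    have : x^-1 + x <= m.+2%:R by rewrite ltW// (lt_trans hm)// ltr_nat.
    by apply: le_trans; rewrite lerDr invr_ge0 ltW.
  move: x0 => [m _]; rewrite /F/= !in_itv/= => /andP[h _].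
  by rewrite (lt_le_trans _ h)// invr_gt0.
have mf : measurable_fun setT (fun x : R => (x^-1 / (1 + (ln x - c) ^+ 2))%:E).
  apply/measurable_EFinP.
  apply: measurable_funM; first exact: measurable_invr.
  apply: (measurableT_comp (measurable_invr R)).
  apply: measurable_funD => //; apply: measurable_funX.
  apply: measurable_funB => //; exact: measurable_ln.
apply: (cvge_to_le (f := fun i => (\int[lebesgue_measure]_(x in F i)
    (x^-1 / (1 + (ln x - c) ^+ 2))%:E)%E) (a := \oo)).
  rewrite FE; apply: ge0_nondecreasing_set_cvg_integral.
  - move=> n m nm; apply/subsetPset => x; rewrite /F/= !in_itv/= => /andP[h1 h2].
    apply/andP; split.
      by rewrite (le_trans _ h1)// lef_pV2 ?posrE// ler_nat.
    by rewrite (le_trans h2)// ler_nat.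
  - by move=> i; exact: measurable_itv.
  - by move=> i; exact: measurable_funS mf.
  - move=> i x; rewrite /F/= in_itv/= => /andP[h _]; rewrite lee_fin.
    rewrite divr_ge0//; last by rewrite addr_ge0// sqr_ge0.
    by rewrite invr_ge0 (le_trans _ h)// invr_ge0.
apply: nearW => n; apply: integral_atan_ln_le => //.
by rewrite (@le_lt_trans _ _ 1)// ?ltr1n// invf_le1// n1.
Qed.

(** Substituting [y = x / mu] removes [mu] from the integral, so a single [K] can serve all [mu].
    The exponent is halved because the other half of the exponential density is spent on making the
    noise beyond the threshold small. *)
Definition exp_log_sqr_bound {R : realType} (K : R) : Prop :=
  forall mu : R, 0 < mu ->
  (\int[lebesgue_measure]_(x in `[0%R, +oo[)
     (expR (- (x / mu / 2)) / mu * ln (x / mu) ^+ 2)%:E <= K%:E)%E.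

(* [x^-1 / (1 + (ln x - ln mu)^2)] has the bounded antiderivative
   [atan (ln x - ln mu)] and dominates the integrand uniformly in [mu]. *)
Lemma integral_ln_sqr_expR_bounded (R : realType) :
  exists2 K : R, 0 <= K & exp_log_sqr_bound K.
Proof.
have [C C0 hC] : exists2 C : R, 0 <= C & forall y, 0 < y ->
    y * expR (- (y / 2)) * (ln y ^+ 2 * (1 + ln y ^+ 2)) <= C.
  by exists 7680; [lra|exact: ln_sqr_expR_le].
exists (C * pi) => [|mu mu0]; first by rewrite mulr_ge0// pi_ge0.
have mf : measurable_fun setT
    (fun x : R => (expR (- (x / mu / 2)) / mu * ln (x / mu) ^+ 2)%:E).
  apply/measurable_EFinP; apply: measurable_funM.
    apply: measurable_funM => //.
    apply: (measurableT_comp (@measurable_expR R)).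
    by apply: measurable_funN; do 2 apply: measurable_funM => //.
  apply: measurable_funX; apply: (measurableT_comp (@measurable_ln R)).
  exact: measurable_funM.
(* The null point 0 is dropped because the comparison with the [atan] derivative holds only for
   positive [x]. *)
rewrite -integral_itv_obnd_cbnd; last exact: measurable_funTS mf.
have mg : measurable_fun setT (fun x : R => (x^-1 / (1 + (ln x - ln mu) ^+ 2))%:E).
  apply/measurable_EFinP.
  apply: measurable_funM; first exact: measurable_invr.
  apply: (measurableT_comp (measurable_invr R)).
  apply: measurable_funD => //; apply: measurable_funX.
  apply: measurable_funB => //; exact: measurable_ln.
have g0 (x : R) : x \in `]0%R, +oo[ -> 0 <= x^-1 / (1 + (ln x - ln mu) ^+ 2).
  rewrite in_itv/= andbT => x0; rewrite divr_ge0//.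
    by rewrite invr_ge0 ltW.
  by rewrite addr_ge0// sqr_ge0.
rewrite EFinM.
apply: (@le_trans _ _ (C%:E * \int[lebesgue_measure]_(x in `]0%R, +oo[)
    (x^-1 / (1 + (ln x - ln mu) ^+ 2))%:E)%E); last first.
  by apply: lee_wpmul2l; [rewrite lee_fin|exact: integral_oo_atan_ln_le].
rewrite -ge0_integralZl_EFin//; last exact: measurable_funTS mg.
apply: ge0_le_integral => //.
- move=> x _; rewrite lee_fin mulr_ge0 ?sqr_ge0// divr_ge0 ?expR_ge0//.
  exact: ltW.
- exact: measurable_funTS mf.
- by apply: measurable_funeM; exact: measurable_funTS mg.
move=> x; rewrite /= in_itv/= andbT => x0.
rewrite lee_fin -ln_div ?posrE//.
have y0 : 0 < x / mu by rewrite divr_gt0.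
have h := hC _ y0.
set l := ln (x / mu) in h *.
have l1 : 0 < 1 + l ^+ 2 by rewrite ltr_wpDr// sqr_ge0.
rewrite [leRHS]mulrA ler_pdivlMr// ler_pdivlMr//.
apply: le_trans h; rewrite le_eqVlt; apply/orP; left; apply/eqP.
by ring.
Qed.

(** * Exponential probabilities and measurability of the risk *)

Lemma integral_expR_itv (R : realType) (mu s : R) : 0 < mu -> 0 < s ->
  (\int[lebesgue_measure]_(x in `[0%R, s]) (expR (- (x / mu)) / mu)%:E =
   (1 - expR (- (s / mu)))%:E)%E.
Proof.
move=> mu0 s0; rewrite (_ : - (s / mu) = - mu^-1 * s); last by ring.
rewrite EFinB -(exponential_prob_itv0c mu^-1 s0) /exponential_prob.
apply: eq_integral => x; rewrite inE/= in_itv/= => /andP[x0 _].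
rewrite exponential_pdfE//; congr EFin.
by rewrite mulrC; congr (_ * expR _); ring.
Qed.

(** By Tonelli, integrating a jointly measurable nonnegative function in [x] leaves a measurable
    function of [mu]. *)
Lemma measurable_cond_risk (R : realType) (delta : R -> R) :
  measurable_fun (`[0%R, +oo[%classic : set R) delta ->
  measurable_fun (`[1%R, +oo[%classic : set R) (cond_risk delta).
Proof.
move=> /(measurable_restrictT _ (measurable_itv _)).1 md.
set d := delta \_ _ in md.
(* Extends the integrand to the whole plane: [delta] is continued by 0, the indicator restores the
   domain of [x], and the absolute value keeps [h] nonnegative for every [mu] without changing it
   when [mu >= 1]. *)
pose h (z : R * R) : \bar R :=
  (expR (- (z.2 / z.1)) / `|z.1| * (ln (d z.2) - ln z.1) ^+ 2 *
   \1_(`[0%R, +oo[%classic : set R) z.2)%:E.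
have mh : measurable_fun setT h.
  apply/measurable_EFinP; apply: measurable_funM; last first.
    by apply: (measurableT_comp (measurable_indic _)).
  apply: measurable_funM; last first.
    apply: measurable_funX; apply: measurable_funB.
      apply: (measurableT_comp (@measurable_ln R)).
      exact: (measurableT_comp md).
    exact: (measurableT_comp (@measurable_ln R)).
  apply: measurable_funM.
    apply: (measurableT_comp (@measurable_expR R)); apply: measurable_funN.
    apply: measurable_funM => //.
    exact: (measurableT_comp (measurable_invr R)).
  apply: (measurableT_comp (measurable_invr R)).
  exact: (measurableT_comp (@normr_measurable R setT)).
have h0 z : (0 <= h z)%E.
  by rewrite lee_fin mulr_ge0// mulr_ge0 ?sqr_ge0// divr_ge0 ?expR_ge0.
have := measurable_fun_fubini_tonelli_F (m2 := @lebesgue_measure R) h mh h0.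
move=> /(measurable_funS measurableT (@subsetT _ (`[1%R, +oo[%classic : set R))).
apply: eq_measurable_fun => mu; rewrite inE/= in_itv/= andbT => mu1.
rewrite /fubini_F /cond_risk [RHS]integral_mkcond; apply: eq_integral => x _.
rewrite /h /= patchE indicE /d patchE; case: ifP => _; last by rewrite mulr0.
by rewrite mulr1 ger0_norm// (le_trans _ mu1).
Qed.

(** Isolates the factor [x^p], which the moment constraint controls when [x = ln mu]. *)
Lemma sqr_powR_split (R : realType) (p x : R) : 0 <= x -> 0 < p ->
  x ^+ 2 = x `^ (2 - p) * x `^ p.
Proof.
move=> x0 p0; rewrite -powRD ?subrK ?powR_mulrn//.
by apply/implyP => /eqP h; exfalso; lra.
Qed.

(** * Upper bound: risk of the hard threshold estimator *)

Definition threshold_estimator {R : realType} (t x : R) : R :=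
  if x <= t then 1 else x.

Lemma measurable_threshold_estimator (R : realType) (t : R) :
  measurable_fun setT (threshold_estimator t).
Proof. by apply: measurable_fun_ifT => //; exact: measurable_fun_ler. Qed.

Lemma admissible_threshold_estimator (R : realType) (t : R) : 0 <= t ->
  admissible_estimator (threshold_estimator t).
Proof.
move=> t0; split.
  exact: measurable_funTS (measurable_threshold_estimator _ t).
move=> x x0; rewrite /threshold_estimator.
by case: (leP x t) => // tx; exact: le_lt_trans tx.
Qed.

(* For [t < mu], with [th = ln mu] and [T = ln t], the probability that
   [X <= t] is at most [t / mu = e^(T - th)], and [th^(2-p) e^(-th)] is
   decreasing beyond [T >= 2]. *)
Lemma threshold_bias_le (R : realType) (p t mu : R) :
  0 < p < 2 -> 0 < t -> 2 <= ln t -> 1 <= mu ->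
  ln mu ^+ 2 * (1 - expR (- (t / mu))) <= ln t `^ (2 - p) * ln mu `^ p.
Proof.
move=> /andP[p0 p2] t0 t2 mu1.
have mu0 : 0 < mu by lra.
have th0 := ln_ge0 mu1.
set th := ln mu in th0 *; set T := ln t in t2 *.
have q0 : 0 <= 2 - p by lra.
have e0 := expR_gt0 (- (t / mu)).
have [thT|Tth] := leP th T.
  apply: (@le_trans _ _ (th ^+ 2)).
    by rewrite ler_piMr ?sqr_ge0//; lra.
  rewrite (sqr_powR_split _ p)// ler_wpM2r ?powR_ge0//.
  by apply: ge0_ler_powR => //; rewrite nnegrE; lra.
have tmu : t / mu = expR (T - th).
  by rewrite expRB /T /th !lnK.
have h1 : 1 - expR (- (t / mu)) <= expR (T - th).
  by have := expR_ge1Dx (- (t / mu)); rewrite -tmu; lra.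
apply: (@le_trans _ _ (th ^+ 2 * expR (T - th))).
  by rewrite ler_wpM2l ?sqr_ge0.
have th1 : 0 < th by lra.
have T1 : 0 < T by lra.
rewrite (sqr_powR_split _ p)// mulrAC ler_wpM2r ?powR_ge0//.
rewrite /powR !gt_eqF// -expRD ler_expR.
have h2 : ln th - ln T <= th / T - 1.
  rewrite -ln_div ?posrE//.
  rewrite (_ : th / T = 1 + (th / T - 1)); last by ring.
  have h : 0 < th / T by rewrite divr_gt0.
  by rewrite [leRHS](_ : _ = th / T - 1); [apply: le_ln1Dx; lra|ring].
have h3 : (2 - p) * (ln th - ln T) <= (2 - p) * (th / T - 1) by rewrite ler_wpM2l.
have h4 : th / T - 1 = (th - T) / T by field; rewrite gt_eqF.
(* This is where [T >= 2] enters: it gives [(2 - p) / T <= 1]. *)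
have h5 : (2 - p) * ((th - T) / T) <= th - T.
  rewrite mulrA ler_pdivrMr// mulrC ler_wpM2l; lra.
rewrite h4 in h3; lra.
Qed.

(** Split at [t]. Up to [t] the loss is the constant [ln mu ^ 2], weighted by the probability that
    [X <= t]. Beyond [t], one factor [e^(-x/(2 mu))] of the density is bounded pointwise, and the
    other is integrated against the squared noise, giving at most [K]. *)
Lemma cond_risk_threshold_le (R : realType) (K p t mu : R) :
  exp_log_sqr_bound K ->
  0 < p < 2 -> 0 < t -> 2 <= ln t -> 1 <= mu ->
  (cond_risk (threshold_estimator t) mu <=
   ((ln t `^ (2 - p) + K) * ln mu `^ p + K * expR (- (t / (2 * expR 1))))%:E)%E.
Proof.
move=> hK p02 t0 t2 mu1.
have mu0 : 0 < mu by lra.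
have th0 := ln_ge0 mu1.
have mf : measurable_fun setT (fun x : R => ((expR (- (x / mu)) / mu) *
    (ln (threshold_estimator t x) - ln mu) ^+ 2)%:E).
  apply/measurable_EFinP; apply: measurable_funM.
    exact: measurable_exp_density.
  apply: measurable_funX; apply: measurable_funB => //.
  apply: (measurableT_comp (@measurable_ln R)).
  exact: measurable_threshold_estimator.
have f0 (x : R) : 0 <= (expR (- (x / mu)) / mu) *
    (ln (threshold_estimator t x) - ln mu) ^+ 2.
  by rewrite mulr_ge0 ?sqr_ge0// divr_ge0 ?expR_ge0// ltW.
have mh : measurable_fun setT
    (fun x : R => (expR (- (x / mu / 2)) / mu * ln (x / mu) ^+ 2)%:E).
  apply/measurable_EFinP; apply: measurable_funM.
    apply: measurable_funM => //.
    apply: (measurableT_comp (@measurable_expR R)).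
    by apply: measurable_funN; do 2 apply: measurable_funM => //.
  apply: measurable_funX; apply: (measurableT_comp (@measurable_ln R)).
  exact: measurable_funM.
have h0 (x : R) : 0 <= expR (- (x / mu / 2)) / mu * ln (x / mu) ^+ 2.
  by rewrite mulr_ge0 ?sqr_ge0// divr_ge0 ?expR_ge0// ltW.
have me : measurable_fun setT (fun x : R => (expR (- (x / mu)) / mu)%:E).
  by apply/measurable_EFinP; exact: measurable_exp_density.
have -> : cond_risk (threshold_estimator t) mu =
    (\int[lebesgue_measure]_(x in `[0%R, t]) ((expR (- (x / mu)) / mu) *
       (ln (threshold_estimator t x) - ln mu) ^+ 2)%:E +
     \int[lebesgue_measure]_(x in `]t, +oo[) ((expR (- (x / mu)) / mu) *
       (ln (threshold_estimator t x) - ln mu) ^+ 2)%:E)%E.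
  rewrite -ge0_integral_setU//.
  - congr integral; apply/seteqP; split => x /=; rewrite !in_itv/= ?andbT.
      by move=> x0; have [xt|xt] := leP x t; [left|right]; rewrite ?x0.
    by move=> [/andP[]//|]; lra.
  - exact: measurable_funTS mf.
  - by move=> x _; rewrite lee_fin.
  - rewrite disj_set2E; apply/eqP/seteqP; split => x //= []; rewrite !in_itv/= andbT.
    by move=> /andP[_ xt]; lra.
(* [C] bounds [e^(-x/(2 mu))] for [x > t]: the first term is at least 1 when [ln mu >= 1]; otherwise
   [mu < e] and the second term suffices. *)
set C := ln mu `^ p + expR (- (t / (2 * expR 1))).
have C0 : 0 <= C by rewrite addr_ge0 ?powR_ge0 ?expR_ge0.
rewrite [X in (_ <= X%:E)%E](_ : _ = ln t `^ (2 - p) * ln mu `^ p + C * K); last first.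
  by rewrite /C; ring.
rewrite EFinD; apply: leeD.
  under eq_integral => x.
    rewrite inE/= in_itv/= => /andP[_ xt].
    rewrite /threshold_estimator xt ln1 sub0r sqrrN mulrC EFinM.
    over.
  rewrite ge0_integralZl_EFin ?sqr_ge0//.
  - by rewrite integral_expR_itv// -EFinM lee_fin threshold_bias_le.
  - by move=> x _; rewrite lee_fin divr_ge0 ?expR_ge0// ltW.
  - exact: measurable_funTS me.
rewrite EFinM.
apply: (@le_trans _ _ (C%:E * \int[lebesgue_measure]_(x in `[0%R, +oo[)
     (expR (- (x / mu / 2)) / mu * ln (x / mu) ^+ 2)%:E)%E); last first.
  by apply: lee_wpmul2l; [rewrite lee_fin|exact: hK].
rewrite -ge0_integralZl_EFin//;
  [|by move=> x _; rewrite lee_fin|exact: measurable_funTS mh].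
apply: (@le_trans _ _ (\int[lebesgue_measure]_(x in `]t, +oo[)
     (C%:E * (expR (- (x / mu / 2)) / mu * ln (x / mu) ^+ 2)%:E))%E); last first.
  apply: ge0_subset_integral => //.
  - by apply: measurable_funeM; exact: measurable_funTS mh.
  - by move=> x _; rewrite -EFinM lee_fin mulr_ge0.
  - by move=> x; rewrite /= !in_itv/= !andbT => /ltW; apply: le_trans; exact: ltW.
apply: ge0_le_integral => //.
- by move=> x _; rewrite lee_fin.
- exact: measurable_funTS mf.
- by apply: measurable_funeM; exact: measurable_funTS mh.
move=> x; rewrite /= in_itv/= andbT => tx.
rewrite -EFinM lee_fin /threshold_estimator (lt_geF tx).
have x0 : 0 < x := lt_trans t0 tx.
rewrite -ln_div ?posrE// [leRHS]mulrA ler_wpM2r ?sqr_ge0//.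
rewrite [leRHS]mulrA ler_wpM2r ?invr_ge0 ?(ltW mu0)//.
rewrite (_ : - (x / mu) = - (x / mu / 2) + - (x / mu / 2)); last by field; rewrite gt_eqF.
rewrite expRD ler_wpM2r ?expR_ge0//.
have y0 : 0 < x / mu by rewrite divr_gt0.
rewrite /C; have [th1|th1] := leP 1 (ln mu).
  have h1 : 1 <= ln mu `^ p.
    have [p0 _] := andP p02.
    rewrite -[leLHS](congr1 (fun f => f p) (powR1 R)).
    by apply: ge0_ler_powR => //; rewrite ?nnegrE; lra.
  have : expR (- (x / mu / 2)) <= 1 by rewrite expR_le1; lra.
  have := expR_gt0 (- (t / (2 * expR 1))); lra.
suff : expR (- (x / mu / 2)) <= expR (- (t / (2 * expR 1))).
  have := powR_ge0 (ln mu) p; lra.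
rewrite ler_expR lerN2.
have mue : mu <= expR 1 by rewrite -[mu]lnK ?posrE// ler_expR ltW.
have -> : x / mu / 2 = x / (2 * mu) by field; rewrite gt_eqF.
rewrite ler_pdivlMr ?mulr_gt0// mulrAC ler_pdivrMr ?mulr_gt0 ?expR_gt0//.
by apply: ler_pM; rewrite ?ler_pM2l// ?ltW// mulr_gt0.
Qed.

(** The conditional bound is affine in [(ln mu)^p], so integrating it against any [F] needs only the
    moment constraint and total mass 1. *)
Lemma minimax_bayes_risk_le (R : realType) (K p t eta : R) :
  0 <= K ->
  exp_log_sqr_bound K ->
  0 < p < 2 -> 0 < t -> 2 <= ln t ->
  (minimax_bayes_risk p eta <=
   ((ln t `^ (2 - p) + K) * eta `^ p + K * expR (- (t / (2 * expR 1))))%:E)%E.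
Proof.
move=> K0 hK p02 t0 t2.
apply: (@le_trans _ _ (ereal_sup [set r | exists F : probability R R,
    in_Fp p eta F /\ r = bayes_risk F (threshold_estimator t)])).
  apply: ereal_inf_lbound; exists (threshold_estimator t); split => //.
  by apply: admissible_threshold_estimator; exact: ltW.
apply: ge_ereal_sup => _ [F [[F1 Fp] ->]].
set A := ln t `^ (2 - p) + K; set B := K * expR _.
have A0 : 0 <= A by rewrite addr_ge0 ?powR_ge0.
have B0 : 0 <= B by rewrite mulr_ge0 ?expR_ge0.
have mp : measurable_fun setT (fun mu : R => (ln mu `^ p)%:E).
  apply/measurable_EFinP; apply: (measurableT_comp (@measurable_powR R p)).
  exact: measurable_ln.
apply: (@le_trans _ _ (\int[F]_(mu in (`[1%R, +oo[%classic : set R))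
    (A%:E * (ln mu `^ p)%:E + B%:E))%E).
  apply: ge0_le_integral => //.
  - move=> mu; rewrite /= in_itv/= andbT => mu1; apply: integral_ge0 => x _.
    rewrite lee_fin mulr_ge0 ?sqr_ge0// divr_ge0 ?expR_ge0//.
    by rewrite (le_trans _ mu1).
  - apply: measurable_cond_risk; apply: measurable_funTS.
    exact: measurable_threshold_estimator.
  - apply: measurable_funTS; apply: emeasurable_funD => //.
    exact: measurable_funeM.
  - move=> mu; rewrite /= in_itv/= andbT => mu1.
    by rewrite -EFinM -EFinD; exact: cond_risk_threshold_le.
rewrite ge0_integralD//.
- rewrite (EFinD (A * _)); apply: leeD.
    rewrite ge0_integralZl_EFin// ?EFinM.
    + by apply: lee_wpmul2l => //; rewrite lee_fin.
    + by move=> x _; rewrite lee_fin powR_ge0.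
    + exact: measurable_funTS mp.
  by rewrite integral_cst// [X in (_ * X)%E](_ : _ = 1%E) ?mule1.
- by move=> x _; rewrite -EFinM lee_fin mulr_ge0// powR_ge0.
- by apply: measurable_funeM; exact: measurable_funTS mp.
Qed.

(** * Lower bound: Bayes risk under a two-point prior *)

Definition two_point {R : realType} (mu : R) (b : bool) : R := if b then mu else 1.

Lemma measurable_two_point {R : realType} (mu : R) :
  measurable_fun setT (two_point mu).
Proof. by []. Qed.

HB.instance Definition _ (R : realType) (mu : R) :=
  isMeasurableFun.Build _ _ _ _ (two_point mu) (measurable_two_point mu).

(** As the image of a Bernoulli law it is a probability by construction, and its integrals reduce to
    sums of two terms. *)
Definition two_point_prior {R : realType} (eps mu : R) : probability R R :=
  distribution (bernoulli_prob eps) (two_point mu).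

Lemma integral_two_point_prior (R : realType) (eps mu : R) (f : R -> \bar R) :
  0 <= eps <= 1 -> 1 <= mu ->
  measurable_fun (`[1%R, +oo[%classic : set R) f ->
  (forall x, 1 <= x -> (0 <= f x)%E) ->
  (\int[two_point_prior eps mu]_(x in (`[1%R, +oo[%classic : set R)) f x =
   eps%:E * f mu + (1 - eps)%:E * f 1%R)%E.
Proof.
move=> eps01 mu1 mf f0.
have pre : two_point mu @^-1` (`[1%R, +oo[%classic : set R) = setT.
  by apply/seteqP; split => // -[] _; rewrite /= in_itv/= andbT.
rewrite ge0_integral_pushforward//; last first.
  by move=> x; rewrite inE/= in_itv/= andbT; exact: f0.
rewrite pre integral_bernoulli_prob// => -[]; exact: f0.
Qed.

(** For [a = M b] the left side is the minimum of the right side over [d], attained at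
    [d = th / (M + 1)]; completing the square shows it. *)
Lemma weighted_sqr_ge (R : realType) (a b M th d : R) :
  0 <= b -> 0 <= M -> M * b <= a ->
  b * (th ^+ 2 * (M / (M + 1))) <= b * (d - th) ^+ 2 + a * d ^+ 2.
Proof.
move=> b0 M0 Mba.
have M1 : 0 < M + 1 by lra.
have h1 : M * b * d ^+ 2 <= a * d ^+ 2 by rewrite ler_wpM2r ?sqr_ge0.
have h2 : b * (d - th) ^+ 2 + M * b * d ^+ 2 - b * (th ^+ 2 * (M / (M + 1))) =
    b * ((M + 1) * d - th) ^+ 2 / (M + 1) by field; rewrite gt_eqF.
have h3 : 0 <= b * ((M + 1) * d - th) ^+ 2 / (M + 1).
  by rewrite divr_ge0 ?(ltW M1)// mulr_ge0 ?sqr_ge0.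
by rewrite -h2 in h3; lra.
Qed.

(** Both risks are restricted to [[0, s]]. There the density at mean 1 is at least [e^(-s)] and that
    at [mu] at most 1, so the last hypothesis makes the posterior odds of 1 against [mu] at least
    [M], and the weighted square inequality applies pointwise in [x]. *)
Lemma two_point_risk_ge (R : realType) (delta : R -> R) (eps mu s M : R) :
  measurable_fun (`[0%R, +oo[%classic : set R) delta ->
  0 <= eps <= 1 -> 1 <= mu -> 0 < s -> 0 <= M ->
  M * eps <= (1 - eps) * expR (- s) ->
  ((eps * ln mu ^+ 2 * (M / (M + 1)) * (1 - expR (- (s / mu))))%:E <=
   eps%:E * cond_risk delta mu + (1 - eps)%:E * cond_risk delta 1%R)%E.
Proof.
move=> md /andP[eps0 eps1] mu1 s0 M0 hM.
pose f (m x : R) := (expR (- (x / m)) / m) * (ln (delta x) - ln m) ^+ 2.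
have mf m : measurable_fun (`[0%R, +oo[%classic : set R) (fun x => (f m x)%:E).
  apply/measurable_EFinP; apply: measurable_funM.
    exact: measurable_funTS (measurable_exp_density _ m).
  apply: measurable_funX; apply: measurable_funB => //.
  exact: (measurableT_comp (@measurable_ln R)).
have f0 m x : 1 <= m -> 0 <= f m x.
  move=> m1; rewrite mulr_ge0 ?sqr_ge0// divr_ge0 ?expR_ge0//.
  by rewrite (le_trans _ m1).
have sub : `[0%R, s]%classic `<=` (`[0%R, +oo[%classic : set R).
  by move=> x; rewrite /= !in_itv/= andbT => /andP[].
have mfs m : measurable_fun (`[0%R, s]%classic : set R) (fun x => (f m x)%:E).
  exact: measurable_funS (mf m).
have restr m : 1 <= m ->
    (\int[lebesgue_measure]_(x in `[0%R, s]) (f m x)%:E <= cond_risk delta m)%E.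
  move=> m1; apply: ge0_subset_integral => //; first exact: mf.
  by move=> x _; rewrite lee_fin f0.
have e0 : 0 <= 1 - eps by lra.
apply: (@le_trans _ _ (eps%:E * \int[lebesgue_measure]_(x in `[0%R, s]) (f mu x)%:E +
   (1 - eps)%:E * \int[lebesgue_measure]_(x in `[0%R, s]) (f 1 x)%:E)%E); last first.
  by apply: leeD; apply: lee_wpmul2l; rewrite ?lee_fin// restr.
rewrite -!ge0_integralZl_EFin//;
  [|by move=> x _; rewrite lee_fin f0|exact: mfs
   |by move=> x _; rewrite lee_fin f0|exact: mfs].
rewrite -ge0_integralD//;
  [|by move=> x _; rewrite -EFinM lee_fin mulr_ge0// f0|by apply: measurable_funeM; exact: mfs
   |by move=> x _; rewrite -EFinM lee_fin mulr_ge0// f0|by apply: measurable_funeM; exact: mfs].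
have c0 : 0 <= eps * ln mu ^+ 2 * (M / (M + 1)).
  apply: mulr_ge0; first by rewrite mulr_ge0// sqr_ge0.
  by rewrite divr_ge0//; lra.
have me : measurable_fun setT (fun x : R => (expR (- (x / mu)) / mu)%:E).
  by apply/measurable_EFinP; exact: measurable_exp_density.
have mu0 : 0 < mu by lra.
have emu0 (x : R) : 0 <= expR (- (x / mu)) / mu.
  by rewrite divr_ge0 ?expR_ge0// ltW.
rewrite EFinM -integral_expR_itv// -ge0_integralZl_EFin//;
  [|by move=> x _; rewrite lee_fin|exact: measurable_funTS me].
apply: ge0_le_integral => //.
- by move=> x _; rewrite -EFinM lee_fin mulr_ge0.
- by apply: measurable_funeM; exact: measurable_funTS me.
- by apply: emeasurable_funD; apply: measurable_funeM; exact: mfs.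
move=> x; rewrite /= in_itv/= => /andP[x0 xs].
rewrite -!EFinM -EFinD lee_fin /f ln1 subr0 divr1 invr1 mulr1.
set b := expR (- (x / mu)) / mu.
have b1 : b <= 1.
  rewrite /b ler_pdivrMr// mul1r (le_trans _ mu1)// expR_le1.
  by rewrite oppr_le0 divr_ge0// ltW.
have ab : M * (eps * b) <= (1 - eps) * expR (- x).
  apply: (@le_trans _ _ (M * eps)).
    by rewrite mulrA ler_piMr// mulr_ge0.
  by rewrite (le_trans hM)// ler_wpM2l// ler_expR lerN2.
have := weighted_sqr_ge _ _ _ _ (ln mu) (ln (delta x)) (mulr_ge0 eps0 (emu0 x)) M0 ab.
rewrite -/b !mulrA; apply: le_trans; rewrite le_eqVlt; apply/orP; left; apply/eqP.
by ring.
Qed.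

(** One prior, chosen before [delta], bounds the supremum below for every [delta]. Its atom at 1
    adds nothing to the moment, since [ln 1 = 0] and [p > 0]. *)
Lemma minimax_bayes_risk_ge (R : realType) (p eta eps mu s M : R) :
  0 < p -> 0 <= eps <= 1 -> 1 <= mu -> 0 < s -> 0 <= M ->
  eps * ln mu `^ p <= eta `^ p ->
  M * eps <= (1 - eps) * expR (- s) ->
  ((eps * ln mu ^+ 2 * (M / (M + 1)) * (1 - expR (- (s / mu))))%:E <=
   minimax_bayes_risk p eta)%E.
Proof.
move=> p0 eps01 mu1 s0 M0 heta hM.
apply: le_ereal_inf_tmp => _ [delta [[md _] ->]].
apply: le_ereal_sup_tmp; exists (bayes_risk (two_point_prior eps mu) delta).
  exists (two_point_prior eps mu); split => //; split.
    rewrite /supported_on_ge1 /= /distribution /pushforward.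
    rewrite (_ : _ @^-1` _ = setT) ?probability_setT//.
    by apply/seteqP; split => // -[] _; rewrite /= in_itv/= andbT.
  rewrite integral_two_point_prior//.
  - by rewrite ln1 powR0 ?gt_eqF// mule0 adde0 -EFinM lee_fin.
  - apply: measurable_funTS; apply/measurable_EFinP.
    apply: (measurableT_comp (@measurable_powR R p)); exact: measurable_ln.
  - by move=> x _; rewrite lee_fin powR_ge0.
rewrite /bayes_risk integral_two_point_prior//.
- exact: two_point_risk_ge.
- exact: measurable_cond_risk.
- move=> x x1; apply: integral_ge0 => y _.
  rewrite lee_fin mulr_ge0 ?sqr_ge0// divr_ge0 ?expR_ge0//.
  by rewrite (le_trans _ x1).
Qed.

(** * Limits of logarithms, powers and the two bounding ratios *)

Lemma ln_cvgy (R : realType) : @ln R x @[x --> +oo] --> +oo.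
Proof.
apply/cvgryPge => A; near=> x.
have Ax : expR A <= x by near: x; exact: nbhs_pinfty_ge.
by rewrite -[A]expRK ler_ln ?posrE ?expR_gt0// (lt_le_trans _ Ax)// expR_gt0.
Unshelve. all: by end_near. Qed.

Lemma expRNM_cvgy0 (R : realType) (c : R) : 0 < c ->
  expR (- (c * x)) @[x --> +oo] --> (0 : R).
Proof.
move=> c0; apply: (cvg_comp (fun x : R => c * x) (fun y : R => expR (- y)));
  last exact: cvgr_expR.
by apply: gt0_cvgMry => //; exact: cvg_id.
Qed.

Lemma powRN_cvgy0 (R : realType) (c : R) : 0 < c -> x `^ (- c) @[x --> +oo] --> (0 : R).
Proof.
move=> c0; apply: cvg_trans (cvg_comp _ _ (@ln_cvgy R) (expRNM_cvgy0 _ _ c0)).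
apply: near_eq_cvg; near=> x.
rewrite /= /powR gt_eqF ?mulNr//; near: x; exact: nbhs_pinfty_gt.
Unshelve. all: by end_near. Qed.

Lemma powR_cvg1 (R : realType) (T : Type) (F : set_system T) {FF : Filter F}
    (f : T -> R) (c : R) :
  f x @[x --> F] --> (1 : R) -> f x `^ c @[x --> F] --> (1 : R).
Proof.
move=> f1.
have : expR (c * ln (f x)) @[x --> F] --> expR (c * ln 1).
  apply: continuous_cvg; first exact: continuous_expR.
  apply: cvgM; first exact: cvg_cst.
  apply: continuous_cvg => //; exact: continuous_ln.
rewrite ln1 mulr0 expR0.
apply: cvg_trans; apply: near_eq_cvg.
have : \forall x \near F, 0 < f x by apply: cvgr_gt f1 _ ltr01.
by apply: filterS => x fx; rewrite /powR gt_eqF.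
Qed.

Lemma ln_div_cvgy0 (R : realType) : ln x / x @[x --> +oo] --> (0 : R).
Proof.
apply: (squeeze_cvgr (f := fun=> 0) (h := fun x : R => 2 * x `^ (- (2^-1)))).
- near=> x.
  have x1 : 1 <= x by near: x; exact: nbhs_pinfty_ge.
  have x0 : 0 < x by lra.
  rewrite divr_ge0 ?ln_ge0 ?(ltW x0)//=.
  rewrite ler_pdivrMr//.
  (* Applying [ln y < y] at the square root of [x] gives [ln x <= 2 x^(1/2)]. *)
  have h : ln (x `^ (2^-1)) <= x `^ (2^-1) by rewrite ltW// ln_sublinear// powR_gt0.
  rewrite ln_powR in h.
  have e : x `^ (- 2^-1) * x = x `^ (2^-1).
    rewrite -[X in _ * X](powRr1 (ltW x0)) -powRD; first by congr powR; lra.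
    by apply/implyP => _; rewrite gt_eqF.
  by rewrite -mulrA e; lra.
- exact: cvg_cst.
- rewrite -[X in _ --> X](mulr0 2); apply: cvgM; first exact: cvg_cst.
  apply: powRN_cvgy0.
  by rewrite invr_gt0.
Unshelve. all: by end_near. Qed.

Lemma lnln_inv_cvgy (R : realType) : ln (ln (x^-1)) @[x --> (0 : R)^'+] --> +oo.
Proof.
apply: (cvg_comp _ _ _ (@ln_cvgy R)); apply: (cvg_comp _ _ _ (@ln_cvgy R)).
apply/gtr0_cvgV0; first by near=> x; rewrite invr_gt0; near: x; exact: nbhs_right_gt.
rewrite (_ : unstable.inv_fun _ = id); last by apply/funext => x; rewrite /= invrK.
by apply: cvg_at_right_filter; exact: cvg_id.
Unshelve. all: by end_near. Qed.

Lemma invr_cvgy0 (R : realType) : x^-1 @[x --> +oo] --> (0 : R).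
Proof.
apply/gtr0_cvgV0; last exact: cvg_id.
exact: nbhs_pinfty_gt.
Qed.

Lemma powR_div (R : realType) (a b q : R) : 0 <= a -> 0 < b ->
  (a / b) `^ q = a `^ q / b `^ q.
Proof.
move=> a0 b0; have bq := powR_gt0 q b0.
apply: (mulIf (lt0r_neq0 bq)).
by rewrite -powRM ?divr_ge0 ?(ltW b0)// !divfK ?gt_eqF.
Qed.

Lemma upper_ratio_cvg1 (R : realType) (q c K : R) : 0 < q -> 0 <= c ->
  ((x + c) `^ q + K) / x `^ q @[x --> +oo] --> (1 : R).
Proof.
move=> q0 c0.
have h : (1 + c * x^-1) `^ q + K * x `^ (- q) @[x --> +oo] --> 1 + K * 0.
  apply: cvgD; last by apply: cvgM; [exact: cvg_cst|exact: powRN_cvgy0].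
  apply: powR_cvg1; rewrite -[X in _ --> X]addr0 -[X in _ --> _ + X](mulr0 c).
  apply: cvgD; first exact: cvg_cst.
  by apply: cvgM; [exact: cvg_cst|exact: invr_cvgy0].
rewrite mulr0 addr0 in h; apply: cvg_trans h; apply: near_eq_cvg; near=> x.
have x0 : 0 < x by near: x; exact: nbhs_pinfty_gt.
rewrite powRN mulrDl -powR_div//; last by lra.
by congr (powR _ _ + _); field; rewrite gt_eqF.
Unshelve. all: by end_near. Qed.

(** With [c = p / 2] the factors are the loss ratio [(th / L)^(2-p)], the shrinkage [M / (M + 1)]
    and the probability that [X <= s]. *)
Lemma lower_ratio_cvg1 (R : realType) (q c : R) : 0 < c ->
  ((x - ln x) / x) `^ q * (1 + 2 * expR (- (c * x)))^-1 *
    (1 - expR (- (c * x))) @[x --> +oo] --> (1 : R).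
Proof.
move=> c0.
have e0 := expRNM_cvgy0 _ _ c0.
have h : ((x - ln x) / x) `^ q * (1 + 2 * expR (- (c * x)))^-1 *
    (1 - expR (- (c * x))) @[x --> +oo] --> 1 * (1 + 2 * 0)^-1 * ((1 : R) - 0).
  apply: cvgM; last by apply: cvgB => //; exact: cvg_cst.
  apply: cvgM; last first.
    apply: cvgV; first by rewrite mulr0 addr0 oner_neq0.
    by apply: cvgD; [exact: cvg_cst|apply: cvgM => //; exact: cvg_cst].
  apply: powR_cvg1.
  have g : 1 - ln x / x @[x --> +oo] --> (1 : R) - 0.
    by apply: cvgB; [exact: cvg_cst|exact: ln_div_cvgy0].
  rewrite subr0 in g; apply: cvg_trans g; apply: near_eq_cvg; near=> x.
  by rewrite mulrBl divff// gt_eqF//; near: x; exact: nbhs_pinfty_gt.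
by rewrite mulr0 addr0 invr1 subr0 !mulr1 in h.
Unshelve. all: by end_near. Qed.

(** * The normalised risk in the variable [x = ln (ln (1/eta))] *)

Lemma minimax_ratio_le (R : realType) (K p x : R) :
  0 <= K ->
  exp_log_sqr_bound K ->
  0 < p < 2 -> 1 <= x ->
  (minimax_bayes_risk p (expR (- expR x)) *
     ((expR (- expR x) `^ p * x `^ (2 - p))^-1)%:E <=
   (((x + 3) `^ (2 - p) + 2 * K) / x `^ (2 - p))%:E)%E.
Proof.
move=> K0 hK p02 x1; have /andP[p0 p2] := p02.
set eta := expR (- expR x).
have eta0 : 0 < eta `^ p by rewrite powR_gt0// expR_gt0.
have xp0 : 0 < x `^ (2 - p) by rewrite powR_gt0//; lra.
have t2 : 2 <= ln (expR (x + 3)) by rewrite expRK; lra.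
have hm := minimax_bayes_risk_le _ _ _ _ eta K0 hK p02 (expR_gt0 (x + 3)) t2.
rewrite expRK in hm.
apply: (@le_trans _ _ ((((x + 3) `^ (2 - p) + K) * eta `^ p +
  K * expR (- (expR (x + 3) / (2 * expR 1))))%:E *
  ((eta `^ p * x `^ (2 - p))^-1)%:E)%E).
  by apply: lee_wpmul2r => //; rewrite lee_fin invr_ge0 mulr_ge0// ltW.
(* The shift 3 makes [t / (2e) = e^x e^2 / 2 >= 2 e^x >= p e^x], using [e >= 2] and [p < 2]. *)
have et : expR (- (expR (x + 3) / (2 * expR 1))) <= eta `^ p.
  rewrite /eta -expRM ler_expR mulNr lerN2.
  have e1 : 2 <= expR 1 :> R by have := expR_ge1Dx (1 : R); lra.
  rewrite (_ : x + 3 = x + (1 + 1 + 1)); last by ring.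
  rewrite expRD !expRD.
  rewrite (_ : _ / _ = expR x * (expR 1 * expR 1 / 2)); last first.
    by field; rewrite gt_eqF// expR_gt0.
  by rewrite ler_pM2l ?expR_gt0//; nra.
rewrite -EFinM lee_fin.
apply: (@le_trans _ _ ((((x + 3) `^ (2 - p) + 2 * K) * eta `^ p) *
    (eta `^ p * x `^ (2 - p))^-1)).
  rewrite ler_wpM2r ?invr_ge0 ?mulr_ge0 ?powR_ge0//.
  have := ler_wpM2l K0 et; lra.
rewrite le_eqVlt; apply/orP; left; apply/eqP; field.
by rewrite !gt_eqF.
Qed.

Lemma minimax_ratio_ge (R : realType) (p x : R) :
  0 < p -> 1 <= x -> 1 <= x - ln x -> expR (- expR x) `^ p <= 2^-1 ->
  ((((x - ln x) / x) `^ (2 - p) * (1 + 2 * expR (- (p / 2 * x)))^-1 *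
    (1 - expR (- (p / 2 * x))))%:E <=
   minimax_bayes_risk p (expR (- expR x)) *
     ((expR (- expR x) `^ p * x `^ (2 - p))^-1)%:E)%E.
Proof.
move=> p0 x1 th1 hq.
have x0 : 0 < x by lra.
set eta := expR (- expR x) in hq *; set th := x - ln x in th1 *.
set mu := expR th; set E := expR (p / 2 * x).
have eta0 : 0 < eta `^ p by rewrite powR_gt0// expR_gt0.
have xp0 : 0 < x `^ (2 - p) by rewrite powR_gt0.
have thp1 : 1 <= th `^ p.
  rewrite -[leLHS](congr1 (fun f => f p) (powR1 R)).
  by apply: ge0_ler_powR; rewrite ?nnegrE; lra.
have thp0 : 0 < th `^ p by lra.
have E0 : 0 < E := expR_gt0 _.
(* The largest mass at [mu] that the moment constraint allows. *)
set eps := eta `^ p / th `^ p.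
have eps0 : 0 <= eps by rewrite divr_ge0// ltW.
have epsq : eps <= eta `^ p by rewrite ler_pdivrMr// ler_peMr// ltW.
have eps01 : 0 <= eps <= 1 by apply/andP; split; lra.
have mu1 : 1 <= mu by have := expR_ge1Dx th; rewrite /mu; lra.
have s0 : 0 < p / 2 * expR x by rewrite mulr_gt0 ?expR_gt0//; lra.
have M0 : 0 <= E / 2 by lra.
have heta : eps * ln mu `^ p <= eta `^ p.
  by rewrite /mu expRK /eps divfK// gt_eqF.
(* Since [eta^p = e^(-2s)] with [s = p e^x / 2], one factor [e^(-s)] pays for the likelihood on
   [[0, s]] and the other for [E <= e^s]. The half in [M = E / 2] comes from [1 - eps >= 1/2]. *)
have hM : E / 2 * eps <= (1 - eps) * expR (- (p / 2 * expR x)).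
  have h1 : E <= expR (p / 2 * expR x).
    rewrite ler_expR ler_wpM2l//; first by lra.
    by have := expR_ge1Dx x; lra.
  have h2 : eta `^ p = expR (- (p / 2 * expR x)) * expR (- (p / 2 * expR x)).
    by rewrite /eta -expRM -expRD; congr expR; field.
  have h3 : E * expR (- (p / 2 * expR x)) <= 1.
    by rewrite expRN ler_pdivrMr ?expR_gt0// mul1r.
  have h4 : 0 < expR (- (p / 2 * expR x)) := expR_gt0 _.
  have h5 : E * eps <= expR (- (p / 2 * expR x)).
    apply: (@le_trans _ _ (E * eta `^ p)); first by rewrite ler_pM2l.
    by rewrite h2 mulrA ler_piMl// ltW.
  have h6 : expR (- (p / 2 * expR x)) / 2 <= (1 - eps) * expR (- (p / 2 * expR x)).
    by rewrite mulrC ler_pM2r//; lra.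
  lra.
have := minimax_bayes_risk_ge _ _ _ _ _ _ _ p0 eps01 mu1 s0 M0 heta hM.
have smu : p / 2 * expR x / mu = p / 2 * x.
  by rewrite /mu /th expRB lnK ?posrE//; field; rewrite !gt_eqF ?expR_gt0.
rewrite smu /mu expRK => hm.
apply: (@le_trans _ _ ((eps * th ^+ 2 * (E / 2 / (E / 2 + 1)) *
    (1 - expR (- (p / 2 * x))))%:E * ((eta `^ p * x `^ (2 - p))^-1)%:E)%E); last first.
  by apply: lee_wpmul2r => //; rewrite lee_fin invr_ge0 mulr_ge0// ltW.
rewrite -EFinM lee_fin le_eqVlt; apply/orP; left; apply/eqP.
rewrite powR_div//; last by lra.
rewrite (sqr_powR_split _ p)//; last by lra.
rewrite /eps expRN -/E; field.
by rewrite !gt_eqF//; lra.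
Qed.

Theorem theorem2p3 (R : realType) (p : R) (hp0 : 0 < p) (hp2 : p < 2) :
  (minimax_bayes_risk p eta *
     ((eta `^ p * (ln (ln (eta^-1))) `^ (2 - p))^-1)%:E)%E
    @[eta --> 0^'+] --> 1%E.
Proof.
have p02 : 0 < p < 2 by rewrite hp0.
have q0 : 0 < 2 - p by lra.
have [K K0 hK] := integral_ln_sqr_expR_bounded R.
(* Substituting [eta = e^(-e^x)] turns the limit at 0 into a squeeze at infinity. *)
have cvgx : (minimax_bayes_risk p (expR (- expR x)) *
     ((expR (- expR x) `^ p * x `^ (2 - p))^-1)%:E)%E @[x --> +oo] --> 1%E.
  apply: (squeeze_cvge
    (f := fun x => (((x - ln x) / x) `^ (2 - p) *
       (1 + 2 * expR (- (p / 2 * x)))^-1 * (1 - expR (- (p / 2 * x))))%:E)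
    (h := fun x => (((x + 3) `^ (2 - p) + 2 * K) / x `^ (2 - p))%:E)).
  - near=> x; apply/andP; split.
      apply: minimax_ratio_ge => //.
      + have x2 : 2 <= x by near: x; exact: nbhs_pinfty_ge.
        have : ln x / x < 2^-1.
          near: x; apply: (cvgr_lt _ (ln_div_cvgy0 R)).
          by rewrite invr_gt0.
        by rewrite ltr_pdivrMr; lra.
      (* [p x >= 1] gives [p e^x >= 1], hence [e^(p e^x) >= 2], so [eta^p <= 1/2]. *)
      + have xp : p^-1 <= x by near: x; apply: nbhs_pinfty_ge; exact: num_real.
        rewrite -expRM mulNr expRN -[leRHS]div1r -[leLHS]div1r.
        rewrite ler_pdivlMr// mulrAC ler_pdivrMr ?expR_gt0// !mul1r.
        have := expR_ge1Dx (expR x * p).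
        suff : 1 <= expR x * p by lra.
        rewrite -ler_pdivrMr// div1r (le_trans xp)//.
        by have := expR_ge1Dx x; lra.
    exact: minimax_ratio_le.
  - by apply: cvg_EFin; [exact: nearW|apply: lower_ratio_cvg1; lra].
  - by apply: cvg_EFin; [exact: nearW|apply: upper_ratio_cvg1 => //; lra].
apply: cvg_trans (cvg_comp _ _ (lnln_inv_cvgy R) cvgx).
apply: near_eq_cvg; near=> eta.
have eta0 : 0 < eta by near: eta; exact: nbhs_right_gt.
have L0 : 0 < ln (ln eta^-1).
  by near: eta; apply: cvgry_gt; exact: lnln_inv_cvgy.
(* [ln] is at most 0 on all arguments up to 1, nonpositive ones included, so a positive outer
   logarithm forces a positive inner one. *)
have N0 : 0 < ln eta^-1.
  by rewrite ltNge; apply/negP => h; move: L0; rewrite ltNge ln_le0//; lra.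
by rewrite /= lnK ?posrE// -lnV ?posrE ?invr_gt0// invrK lnK.
Unshelve. all: by end_near. Qed.
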